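(* Let $G$ be a finite non-abelian $2$-group of exponent $4$. Then $G \in \mathcal{G}_3$ if and only if every minimal non-abelian subgroup of $G$ is isomorphic to $Q_8$, $H_2$ or $H_{32}$.
   Context: For a finite group $G$ and a subset $S \subseteq G$ with $1 \notin S$ and $S = S^{-1} = \{s^{-1} : s \in S\}$, the Cayley graph $\mathrm{Cay}(G,S)$ is the simple undirected graph with vertex set $G$ and edges $\{g, sg\}$ for $g \in G$, $s \in S$. A finite simple graph is integral if all eigenvalues of its adjacency matrix are integers. $\mathcal{G}_3$ is the class of all finite groups $G$ such that $\mathrm{Cay}(G,S)$ is integral for every $S \subseteq G$ with $1 \notin S = S^{-1}$ and $|S| \le 3$. A finite group is minimal non-abelian if it is non-abelian and all its proper subgroups are abelian. Conventions: $a^b = b^{-1}ab$ and $[a,b] = a^{-1}b^{-1}ab$. $Q_8$ is the quaternion group of order $8$, $H_2 = \langle a,b \mid a^4=b^4=1,\ a^b=a^{-1} \rangle$ (of order $16$), and $H_{32} = \langle a,b,c \mid a^4=b^4=c^2=1,\ [a,b]=c,\ [c,a]=[c,b]=1 \rangle$ (of order $32$). *)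

(* Defs.v *)
From HB Require Import structures.
From mathcomp Require Import all_boot all_order all_algebra.
From mathcomp Require Import all_fingroup all_solvable all_field.

Set Implicit Arguments.
Unset Strict Implicit.
Unset Printing Implicit Defensive.

Import GroupScope.

(* A simple graph on a finite type is its symmetric irreflexive edge relation. *)
Definition adjacency_mx (T : finType) (e : rel T) : 'M[algC]_#|T| :=
  (\matrix_(i, j) (e (enum_val i) (enum_val j))%:R)%R.

(* Adjacency matrices have entries in {0, 1}, so all their complex eigenvalues
   are algebraic and algC may stand for the field of complex numbers. *)
Definition integral_graph (T : finType) (e : rel T) : Prop :=
  forall a : algC, eigenvalue (adjacency_mx e) a -> a \in Num.int.

(* The vertices are the elements of the group G only, not of the ambient gT. *)
Definition cayley (gT : finGroupType) (G : {group gT}) (S : {set gT}) :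
    rel (subg_of G) :=
  fun x y => [exists s in S, sgval y == s * sgval x].

Lemma cayley_irr (gT : finGroupType) (G : {group gT}) (S : {set gT}) :
  1 \notin S -> irreflexive (@cayley gT G S).
Proof.
move=> S1 x; apply/exists_inP => -[s Ss /eqP/esym].
by rewrite -{2}[sgval x]mul1g => /mulIg s1; rewrite s1 (negPf S1) in Ss.
Qed.

Lemma cayley_sym (gT : finGroupType) (G : {group gT}) (S : {set gT}) :
  S = S^-1 -> symmetric (@cayley gT G S).
Proof.
move=> SV; have imp x y : @cayley gT G S x y -> @cayley gT G S y x.
  case/exists_inP=> s Ss /eqP eq_y; apply/exists_inP; exists s^-1.
    by rewrite SV mem_invg invgK.
  by rewrite eq_y mulKg.
by move=> x y; apply/idP/idP; apply: imp.
Qed.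

Definition in_G3 (gT : finGroupType) (G : {group gT}) : Prop :=
  forall S : {set gT}, S \subset G -> 1 \notin S -> S = S^-1 -> #|S| <= 3 ->
  integral_graph (@cayley gT G S).

Definition minimal_nonabelian (gT : finGroupType) (H : {group gT}) : Prop :=
  ~~ abelian H /\ (forall K : {group gT}, K \proper H -> abelian K).

(* isog Grp means isomorphism with the largest finite quotient of the presented
   group; the two groups presented below are finite (of orders 16 and 32), so
   this is isomorphism with the presented group itself.  The conventions for
   x ^ y and [~ x, y] are y^-1 * x * y and x^-1 * y^-1 * x * y. *)
Definition iso_H2 (gT : finGroupType) (H : {group gT}) : Prop :=
  H \isog Grp (a : b : a ^+ 4 = b ^+ 4 = 1, a ^ b = a^-1).

Definition iso_H32 (gT : finGroupType) (H : {group gT}) : Prop :=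
  H \isog Grp (a : b : c : a ^+ 4 = b ^+ 4 = 1, c ^+ 2 = 1,
                           [~ a, b] = c, [~ c, a] = [~ c, b] = 1).

(* Main.v *)
(* Both sides are equivalent to: every involution of G is central.
   Two non-commuting involutions generate a dihedral group of order 8, hence a
   Cayley graph that is a union of 8-cycles and has an eigenvalue +-sqrt 2.  If
   the involutions commute with each other, but an involution z does not commute
   with some x of order 4, then {x, x^-1, z} has an eigenvalue +-sqrt 5.
   Conversely, if the involutions are central, then any admissible S with at
   most three elements is commutative, so the eigenvalues are sums of fourth
   roots of unity over inverse-closed families, which are integers.
   On the other side, squares are involutions or 1, so when the involutions are
   central a minimal non-abelian subgroup <a, b> has class 2 and is determined
   by the relations between a^2, b^2 and [a, b], where a^2, b^2, [a, b] and
   (a b)^2 = a^2 b^2 [a, b] are all nontrivial; this leaves Q_8, H_2 and H_32.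
   Conversely, an involution that is not central generates, with a suitable
   element, a minimal non-abelian subgroup with a non-central involution, which
   none of these three groups has. *)

Require Import Defs.
From HB Require Import structures.
From mathcomp Require Import all_boot all_order all_algebra.
From mathcomp Require Import all_fingroup all_solvable all_field.
From mathcomp Require Import ring.

Set Implicit Arguments.
Unset Strict Implicit.
Unset Printing Implicit Defensive.

Import GroupScope.
Import GRing.Theory Num.Theory.

(** * Eigenfunctions of Cayley graphs *)

(** The row [v *m A + b *: v] is killed by [A - b], so either it is an eigenvector for [b], or it
    vanishes and [v] is an eigenvector for [-b]. *)
Lemma eigenvalue_sqrt n (A : 'M[algC]_n) (v : 'rV_n) (b : algC) :
  v != 0%R -> (v *m A *m A = (b ^+ 2)%R *: v)%R ->
  eigenvalue A b || eigenvalue A (- b)%R.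
Proof.
move=> v0 vAA; have [w0 | w0] := eqVneq (v *m A + b *: v)%R 0%R.
  apply/orP; right; apply/eigenvalueP; exists v => //.
  by rewrite scaleNr; apply/eqP; rewrite -addr_eq0 w0.
apply/orP; left; apply/eigenvalueP; exists (v *m A + b *: v)%R => //.
by rewrite mulmxDl vAA -scalemxAl scalerDr scalerA -expr2 addrC.
Qed.

Section CayleyEigenfunctions.

Variables (gT : finGroupType) (G : {group gT}) (S : {set gT}).
Hypotheses (sSG : S \subset G) (SV : S = S^-1).

Let adj := adjacency_mx (@cayley gT G S).

(** Functions live on all of [gT], so that translates need no membership proof. Symmetry of [S]
    turns the neighbours [s^-1 * y] of a vertex [y] into the translates [s * y]. *)
Lemma mul_row_cayley (f : gT -> algC) (j : 'I_#|subg_of G|) :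
  ((\row_i f (sgval (enum_val i)) *m adj) 0 j
     = \sum_(s in S) f (s * sgval (enum_val j))%g)%R.
Proof.
rewrite mxE.
transitivity (\sum_(x : subg_of G) f (sgval x)
    * (cayley S x (enum_val j))%:R : algC)%R.
  rewrite [RHS](reindex (fun i : 'I_#|subg_of G| => enum_val i)) /=; last first.
    by exists enum_rank => i _; rewrite ?enum_valK ?enum_rankK.
  by apply: eq_bigr => i _; rewrite !mxE.
set y := enum_val j.
rewrite (bigID (fun x : subg_of G => cayley S x y)) /=.
rewrite [X in (_ + X)%R]big1 ?addr0.
  rewrite (eq_bigr (fun x : subg_of G => f (sgval x))); last first.
    by move=> x ->; rewrite mulr1.
  rewrite [RHS](reindex_onto (fun x => x * (sgval y)^-1)
                             (fun s => s * sgval y)) /=; last first.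
    by move=> s _; rewrite mulgK.
  rewrite [RHS](eq_bigl (fun x => (x \in G) && (x * (sgval y)^-1 \in S))).
    rewrite [RHS](reindex_onto (@sgval gT G) (subg G)) /=; last first.
      by move=> x /andP[Gx _]; rewrite subgK.
    apply: eq_big => [x | x _]; last by rewrite mulgKV.
    rewrite subgP sgvalK eqxx andbT /=.
    apply/exists_inP/idP => [[s Ss /eqP ->]|Sxy].
      by rewrite invMg mulKVg -mem_invg -SV.
    exists (sgval x * (sgval y)^-1)^-1; first by rewrite SV mem_invg invgK.
    by rewrite invMg invgK mulgKV.
  move=> x; rewrite mulgKV eqxx andbT.
  case: (boolP (_ \in S)) => [Sx|]; rewrite ?andbF //.
  rewrite andbT; apply/esym.
  by rewrite -(groupMr x (groupVr (subgP y))) (subsetP sSG).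
by move=> x /negbTE ->; rewrite mulr0.
Qed.

(** The double sum says that the squared adjacency operator acts on [f] as [n], so a square root of
    [n] is an eigenvalue up to sign. Were it an integer, [n] would be a perfect square. The value at
    1 keeps the restriction of [f] to [G] nonzero. *)
Lemma cayley_not_integral (f : gT -> algC) (n : nat) :
    (f 1%g != 0)%R -> (forall m : nat, n != m ^ 2)%N ->
    (forall y, y \in G ->
       \sum_(s in S) \sum_(t in S) f (t * (s * y))%g = n%:R * f y)%R ->
  ~ integral_graph (@cayley gT G S).
Proof.
move=> f1 nsq fTT intG.
pose v := (\row_(i < #|subg_of G|) f (sgval (enum_val i)))%R.
have v0 : v != 0%R.
  apply: contraNneq f1 => /rowP/(_ (enum_rank (1 : subg_of G))).
  by rewrite !mxE enum_rankK => <-.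
have vAA : (v *m adj *m adj = (sqrtC n%:R ^+ 2) *: v)%R.
  pose Tf y := (\sum_(s in S) f (s * y)%g)%R.
  have vA : (v *m adj = \row_i Tf (sgval (enum_val i)))%R.
    by apply/rowP => i; rewrite (mul_row_cayley f) [RHS]mxE.
  apply/rowP=> j; rewrite vA (mul_row_cayley Tf) sqrtCK [RHS]mxE [in RHS]mxE.
  by rewrite -fTT ?subgP.
have sqrt_int : (sqrtC n%:R : algC)%R \is a Num.int.
  by case/orP: (eigenvalue_sqrt v0 vAA) => /intG; rewrite ?rpredN.
have: (sqrtC n%:R : algC)%R \is a Num.nat.
  by rewrite natrEint sqrt_int sqrtC_ge0 ler0n.
case/natrP => m /(congr1 (fun x => x ^+ 2)%R); rewrite sqrtCK -natrX.
by move/eqP; rewrite eqr_nat (negPf (nsq m)).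
Qed.

(** The eigenvector is extended by zero outside [G]. Translations by elements of [S] preserve both
    [G] and its complement, so the equation holds on all of [gT]. *)
Lemma eigenvalue_cayley (a : algC) :
  eigenvalue adj a ->
  exists2 f : gT -> algC, (exists y, f y != 0)%R
    & forall y, (\sum_(s in S) f (s * y)%g = a * f y)%R.
Proof.
case/eigenvalueP=> v vA v0.
pose f y : algC := if y \in G then v 0%R (enum_rank (subg G y)) else 0%R.
have vf : v = (\row_i f (sgval (enum_val i)))%R.
  by apply/rowP=> i; rewrite mxE /f subgP sgvalK enum_valK.
exists f => [|y].
  have /rV0Pn[i vi0] := v0; exists (sgval (enum_val i)).
  by rewrite vf mxE in vi0.
have [Gy | notGy] := boolP (y \in G); last first.
  rewrite /f (negPf notGy) mulr0 big1 // => s Ss.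
  by rewrite groupMl ?(subsetP sSG s Ss) // (negPf notGy).
have /rowP/(_ (enum_rank (subg G y))) := vA.
rewrite {1}vf mul_row_cayley enum_rankK subgK // => ->.
by rewrite mxE /f Gy.
Qed.

End CayleyEigenfunctions.

(* P stands for further linear equations invariant under the translations by
   elements of zs, such as belonging to a given eigenspace. *)
Lemma simultaneous_eigenfun (gT : finGroupType) (zs : seq gT)
    (P : (gT -> algC) -> Prop) (f : gT -> algC) :
    {in zs &, commutative (@mulg gT)} -> {in zs, forall z, z ^+ 4 = 1} ->
    (forall z g (r : algC), z \in zs -> P g ->
       P (fun y => g (z * y)%g - r * g y)%R) ->
    P f -> (exists y, f y != 0)%R ->
  exists g, [/\ P g, (exists y, g y != 0)%R
    & {in zs, forall z, exists2 w, w ^+ 4 = 1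
         & forall y, g (z * y)%g = w * g y}%R].
Proof.
elim: zs P f => [|z zs IH] P f czs zs4 Pcl Pf f0; first by exists f.
have zzs : z \in z :: zs by rewrite mem_head.
have [g [Pg g0 [w w4 gz]]] : exists g, [/\ P g, (exists y, g y != 0)%R
    & exists2 w, w ^+ 4 = 1 & forall y, g (z * y)%g = w * g y]%R.
  (* [z ^+ 4 - 1] kills [f]: divide out its linear factors one at a time. *)
  have step (r : algC) (h : gT -> algC) : (r ^+ 4 = 1)%R -> P h ->
      (exists y, h y != 0)%R ->
      (exists g, [/\ P g, (exists y, g y != 0)%R
         & exists2 w, w ^+ 4 = 1 & forall y, g (z * y)%g = w * g y]%R)
      \/ (exists y, h (z * y)%g - r * h y != 0)%R.
    move=> r4 Ph h0.
    have [/existsP hz|] := boolP [exists y, h (z * y)%g - r * h y != 0]%R.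
      by right.
    rewrite negb_exists => /forallP hz; left; exists h; split=> //.
    exists r => // y; apply/eqP; rewrite -subr_eq0.
    by have := hz y; rewrite negbK.
  have i4 : ('i ^+ 4 = 1 :> algC)%R by rewrite (exprM _ 2 2) sqrCi sqrrN expr1n.
  case: (step 1%R f) => //; first by rewrite expr1n.
  move=> f1P; have Pf1 := Pcl _ _ 1%R zzs Pf.
  case: (step (-1)%R _ _ Pf1 f1P) => //.
    by rewrite (exprM _ 2 2) sqrrN !expr1n.
  move=> f2P; have Pf2 := Pcl _ _ (-1)%R zzs Pf1.
  case: (step 'i%R _ _ Pf2 f2P) => // f3P; have Pf3 := Pcl _ _ 'i%R zzs Pf2.
  case: (step (- 'i)%R _ _ Pf3 f3P) => //.
    by rewrite (exprM _ 2 2) sqrrN -exprM.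
  case=> y /=; rewrite !mulgA.
  have -> : z * z * z * z = 1 by rewrite -(zs4 z zzs) !expgS expg0 mulg1 !mulgA.
  case/eqP.
  have := sqrCi algC; move: ('i : algC)%R => i i2.
  rewrite mul1g; move: (f _) (f _) (f _) (f _) => p q u v.
  transitivity ((v - q) * (1 + i ^+ 2))%R; first by ring.
  by rewrite i2 addrN mulr0.
have zsS : {subset zs <= z :: zs} by move=> u; rewrite inE orbC => ->.
(* The equation obtained for [z] joins the invariant of the induction; it survives the remaining
   steps because the other translations commute with [z]. *)
pose Q h := P h /\ forall y, (h (z * y)%g = w * h y)%R.
have [||u h r zsu [Ph hz]||h [[Ph hz] h0 hzs]] := IH Q g _ _ _ _ g0.
- by move=> u v zu zv; apply: czs; apply: zsS.
- by move=> u /zsS; apply: zs4.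
- split=> [|y]; first by apply: Pcl => //; apply: zsS.
  have -> : u * (z * y) = z * (u * y) by rewrite !mulgA (czs u z) // zsS.
  by rewrite !hz mulrBr mulrCA.
- by [].
exists h; split=> // u; rewrite inE => /predU1P[-> | /hzs //].
by exists w.
Qed.

(** The translations by [S] commute, so they have a common eigenfunction inside the [a]-eigenspace,
    and [a] is the sum of their eigenvalues, which are fourth roots of unity. *)
Lemma cayley_commuting_integral (gT : finGroupType) (G : {group gT})
    (S : {set gT}) :
    S \subset G -> S = S^-1 -> {in S &, commutative (@mulg gT)} ->
    {in S, forall s, s ^+ 4 = 1} ->
  integral_graph (@cayley gT G S).
Proof.
move=> sSG SV cS S4 a /(eigenvalue_cayley sSG SV)[f f0 fa].
have [||z g r|g [ga [y gy0] gS]] := @simultaneous_eigenfun gT (enum S)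
  (fun f => forall y, \sum_(s in S) f (s * y)%g = a * f y)%R f _ _ _ fa f0.
- by move=> u v; rewrite !mem_enum; apply: cS.
- by move=> u; rewrite mem_enum; apply: S4.
- rewrite mem_enum => Sz ga y.
  rewrite sumrB -mulr_sumr ga mulrBr -(ga (z * y)%g) mulrCA.
  congr (_ - _)%R; apply: eq_bigr => s Ss.
  by rewrite !mulgA (cS z s).
pose w s := (g (s * y)%g / g y)%R.
have gw s : s \in S -> (w s ^+ 4 = 1 /\ forall x, g (s * x)%g = w s * g x)%R.
  move=> Ss; have [|c c4 gs] := gS s; first by rewrite mem_enum.
  by rewrite /w gs mulfK.
have wV s : s \in S -> (w s^-1%g = (w s)^-1)%R.
  move=> Ss; have SsV : s^-1 \in S by rewrite SV mem_invg invgK.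
  have [ws4 gs] := gw s Ss; have [_ gsV] := gw _ SsV.
  have ws0 : w s != 0%R.
    by apply: contra_eq_neq ws4 => ->; rewrite expr0n eq_sym oner_eq0.
  apply: (mulfI ws0); rewrite divff //; apply: (mulIf gy0).
  by rewrite mul1r -mulrA -gsV -gs mulKVg.
have a_w : a = (\sum_(s in S) w s)%R.
  by apply: (mulIf gy0); rewrite -ga mulr_suml; apply: eq_bigr => s /gw[_ ->].
have a_wV : a = (\sum_(s in S) (w s)^-1)%R.
  rewrite a_w (reindex_inj invg_inj) /=.
  have SVE s : (s^-1 \in S) = (s \in S) by rewrite [in RHS]SV mem_invg.
  by apply: eq_big => s; rewrite SVE // => /wV.
(* Averaging the sum over [S] with the sum over inverses makes each term the real part of a fourth
   root of unity, that is 1, -1 or 0. *)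
have -> : a = (\sum_(s in S) (w s + (w s)^-1) / 2)%R.
  rewrite -mulr_suml big_split /= -a_w -a_wV -mulr2n -(mulr_natr a 2).
  by rewrite mulfK ?pnatr_eq0.
apply: rpred_sum => s /gw[ws4 _].
have: ((w s ^+ 2 - 1) * (w s ^+ 2 + 1) == 0)%R.
  by rewrite -subr_sqr expr1n -exprM ws4 subrr.
rewrite mulf_eq0 => /orP[].
  rewrite subr_sqr_1 mulf_eq0 subr_eq0 addr_eq0.
  have half : ((1 + 1) / 2 = 1 :> algC)%R by rewrite -mulr2n divff ?pnatr_eq0.
  case/orP=> /eqP->; rewrite ?invrN invr1 -?opprD ?mulNr half;
  by rewrite ?rpredN rpred1.
rewrite addr_eq0 => /eqP w2.
have -> : ((w s)^-1 = - w s)%R.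
  have w0 : w s != 0%R.
    by apply: contra_eq_neq ws4 => ->; rewrite expr0n eq_sym oner_eq0.
  by apply: (mulfI w0); rewrite divff // mulrN -expr2 w2 opprK.
by rewrite subrr mul0r rpred0.
Qed.

(** * Involutions of a group in the class G_3 *)

Section G3Involutions.

Variables (gT : finGroupType) (G : {group gT}).
Hypotheses (G4 : {in G, forall x, x ^+ 4 = 1}) (G3 : in_G3 G).

Let nsq2 m : (2 != m ^ 2)%N.
Proof. by case: m => [|[|m]]; rewrite -?mulnn ?mulSn ?addSn ?addnS. Qed.

Let nsq5 m : (5 != m ^ 2)%N.
Proof. by case: m => [|[|[|m]]]; rewrite -?mulnn ?mulSn ?addSn ?addnS. Qed.

(* With c the central involution of the dihedral group <s, t>, the square of the
   adjacency operator is 2 on functions changing sign under c. *)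
Lemma G3_involutions_commute s t :
  s \in G -> t \in G -> s ^+ 2 = 1 -> t ^+ 2 = 1 -> commute s t.
Proof.
move=> Gs Gt s2 t2; apply/eqP/negPn/negP => nst.
have ss : s * s = 1 by rewrite -s2.
have tt : t * t = 1 by rewrite -t2.
have sV : s^-1 = s by apply/eqP; rewrite eq_invg_mul ss.
have tV : t^-1 = t by apply/eqP; rewrite eq_invg_mul tt.
pose c : gT := (s * t) ^+ 2.
have cc : c * c = 1 by rewrite -expgD G4 ?groupM.
have cV : c^-1 = c by apply/eqP; rewrite eq_invg_mul cc.
have c1 : c != 1.
  apply: contra nst => /eqP c1; rewrite -[t * s]invgK invMg sV tV.
  by rewrite eq_sym eq_invg_mul; apply/eqP.
have ts_c y : t * (s * y) = c * (s * (t * y)).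
  have -> : t * (s * y) = (s * t)^-1 * y by rewrite invMg sV tV mulgA.
  have -> : (s * t)^-1 = (s * t) ^+ 3.
    by apply/eqP; rewrite eq_invg_mul -expgS G4 ?groupM.
  by rewrite expgSr !mulgA.
(* This function is odd under translation by [c], so the cross terms at [s * t] and [t * s]
   cancel. *)
pose f (y : gT) : algC := ((y == 1%g)%:R - (y == c)%:R)%R.
have fc y : f (c * y) = (- f y)%R.
  rewrite /f -eq_invg_mul cV (can2_eq (mulKg c) (mulKVg c)) mulVg opprB.
  by rewrite (eq_sym c).
have neq_st : s \notin [set t] by rewrite inE; apply: contra nst => /eqP->.
have sSG : [set s; t] \subset G by apply/subsetP=> u /set2P[] ->.
have SV : [set s; t] = [set s; t]^-1.
  by apply/setP=> u; rewrite mem_invg !inE -(eqg_inv u s) -(eqg_inv u t) sV tV.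
apply: (@cayley_not_integral _ G [set s; t] _ _ f 2) => //.
- by rewrite /f eqxx (eq_sym 1) (negPf c1) subr0 oner_eq0.
- move=> y _; rewrite !big_setU1 //= !big_set1 !big_setU1 //= !big_set1.
  rewrite (mulgA s s) (mulgA t t) ss tt !mul1g.
  by rewrite ts_c fc; ring.
apply: G3 => //; last by rewrite cards2; case: (s != t).
rewrite !inE negb_or; apply/andP.
by split; apply: contra nst => /eqP <-; rewrite mul1g mulg1.
Qed.

(* With c = [z, x], the square of the adjacency operator of {x, x^-1, z} is 5 on
   functions invariant under x^2 and changing sign under c. *)
Lemma G3_involutions_central z : z \in G -> z ^+ 2 = 1 -> z \in 'Z(G).
Proof.
move=> Gz z2; rewrite inE Gz; apply/centP=> x Gx.
apply/eqP/negPn/negP => nzx.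
have zz : z * z = 1 by rewrite -z2.
have zV : z^-1 = z by apply/eqP; rewrite eq_invg_mul zz.
have x2z : z * x ^+ 2 = x ^+ 2 * z.
  by apply: G3_involutions_commute; rewrite ?groupX // -expgM G4.
have Gzx : z ^ x \in G by rewrite groupJ.
have zzx : z * z ^ x = z ^ x * z.
  by apply: G3_involutions_commute; rewrite // -conjXg z2 conj1g.
pose c : gT := z * z ^ x.
have cc : c * c = 1.
  by rewrite /c {1}zzx -mulgA (mulgA z) zz mul1g -conjMg zz conj1g.
have cV : c^-1 = c by apply/eqP; rewrite eq_invg_mul cc.
have zx_zc : z ^ x = z * c by rewrite mulgA zz mul1g.
have c1 : c != 1.
  apply: contra nzx => /eqP c1; have : z ^ x = z by rewrite zx_zc c1 mulg1.
  by move/conjg_fixP/commgP; rewrite /commute => ->.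
have cz : c * z = z * c by rewrite -zx_zc /c zzx -mulgA zz mulg1.
have cx : c * x = x * c.
  apply/commgP/conjg_fixP; rewrite /c conjMg -conjgM -expg2 [RHS]zzx.
  congr (_ * _).
  by apply/conjg_fixP/commgP.
clearbody c.
have zx : z * x = x * z * c by rewrite conjgC zx_zc mulgA.
have xx2 : x ^+ 2 * x = x * x ^+ 2 by rewrite -expgSr -expgS.
have c_x2 : c * x ^+ 2 = x ^+ 2 * c by apply: commuteX.
have x4 : x ^+ 2 * x ^+ 2 = 1 by rewrite -expgD G4.
have xV : x^-1 = x ^+ 2 * x.
  by apply/eqP; rewrite eq_invg_mul xx2 mulgA -(expg2 x) x4.
have x21 : x ^+ 2 != 1.
  by apply: contra nzx => /eqP x2; apply/eqP/G3_involutions_commute.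
(* If [x ^+ 2 = c], then [x * z] squares to 1, so it commutes with [z], and hence so does [x]. *)
have x2c : x ^+ 2 != c.
  apply: contra nzx => /eqP x2c.
  have : commute (x * z) z.
    apply: G3_involutions_commute; rewrite ?groupM //.
    rewrite expg2 -mulgA (mulgA z x z) zx !mulgA -(mulgA _ c z) cz mulgA.
    by rewrite -(mulgA _ z z) zz mulg1 -(expg2 x) x2c cc.
  move=> xzz; rewrite -[z * x]mulg1 -zz mulgA -(mulgA z x z) -xzz.
  by rewrite -(mulgA x) zz mulg1.
have x2V : (x ^+ 2)^-1 = x ^+ 2 by apply/eqP; rewrite eq_invg_mul x4.
(* The character of the four-group generated by [x ^+ 2] and [c] that is 1 at [x ^+ 2] and -1 at
   [c], extended by zero. *)
pose f (y : gT) : algC := ((y == 1%g)%:R + (y == (x ^+ 2)%g)%:R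
                    - (y == c)%:R - (y == (x ^+ 2 * c)%g)%:R)%R.
have moveE (u v w : gT) : (u * v == w) = (v == u^-1 * w).
  by rewrite (can2_eq (mulKg u) (mulKVg u)).
have fx2 y : f (x ^+ 2 * y) = f y.
  by rewrite /f !moveE x2V mulg1 x4 (mulgA (x ^+ 2) _ c) x4 mul1g; ring.
have fc y : f (c * y) = (- f y)%R.
  by rewrite /f !moveE cV mulg1 cc -c_x2 (mulgA c c) cc mul1g; ring.
have xVx : x != x^-1 by rewrite eq_sym eq_invg_mul.
have xz : x != z by apply: contra nzx => /eqP->.
have xVz : x^-1 != z.
  by apply: contra nzx => /eqP <-; rewrite mulVg mulgV.
have SVE : x |: (x^-1 |: [set z]) = (x |: (x^-1 |: [set z]))^-1.
  apply/setP=> u; rewrite mem_invg !inE -(eqg_inv u x) -(eqg_inv u z) zV.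
  by rewrite -(eqg_inv u x^-1) invgK orbCA.
have sSG : x |: (x^-1 |: [set z]) \subset G.
  by apply/subsetP=> u; rewrite !inE => /or3P[] /eqP->; rewrite ?groupV.
have nx : x \notin x^-1 |: [set z] by rewrite !inE negb_or xVx.
have nxV : x^-1 \notin [set z] by rewrite inE.
apply: (@cayley_not_integral _ G (x |: (x^-1 |: [set z])) _ _ f 5) => //.
- rewrite /f eqxx !(eq_sym 1) (negPf x21) (negPf c1) -eq_invg_mul x2V.
  by rewrite (negPf x2c) addr0 !subr0 oner_eq0.
- move=> y _.
  have sumE (F : gT -> algC) : (\sum_(s in x |: (x^-1%g |: [set z])) F s
                               = F x + (F x^-1%g + F z))%R.
    by rewrite !big_setU1 //= big_set1.
  (* Of the nine terms, five equal [f y]. The other four involve [z] and one of [x], [x^-1];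
     exchanging the two factors changes the sign, so they cancel. *)
  rewrite sumE !sumE mulKg mulKVg.
  have -> : f (x * (x * y)) = f y by rewrite mulgA -(expg2 x) fx2.
  have -> : f (x^-1 * (x^-1 * y)) = f y.
    by rewrite mulgA -invMg -(expg2 x) x2V fx2.
  have -> : f (z * (z * y)) = f y by rewrite mulgA zz mul1g.
  have -> : f (z * (x^-1 * y)) = f (z * (x * y)).
    by rewrite xV -mulgA (mulgA z (x ^+ 2)) x2z -(mulgA (x ^+ 2)) fx2.
  have -> : f (x^-1 * (z * y)) = f (x * (z * y)) by rewrite xV -mulgA fx2.
  have -> : f (z * (x * y)) = (- f (x * (z * y))%g)%R.
    by rewrite (mulgA z) zx -(mulgA x) -cz (mulgA x) -cx -!mulgA fc.
  by ring.
apply: G3 => //.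
  rewrite !inE !negb_or; apply/and3P; split; apply: contra nzx.
  - by move/eqP <-; rewrite mulg1 mul1g.
  - by rewrite eq_sym -eq_invg1 invgK => /eqP->; rewrite mulg1 mul1g.
  - by move/eqP <-; rewrite mulg1 mul1g.
by rewrite !cardsU1 cards1; do 2?case: (_ \notin _).
Qed.

End G3Involutions.

(** * Integrality when all involutions are central *)

Lemma central_involutions_G3 (gT : finGroupType) (G : {group gT}) :
    {in G, forall x, x ^+ 4 = 1} ->
    (forall z, z \in G -> z ^+ 2 = 1 -> z \in 'Z(G)) ->
  in_G3 G.
Proof.
move=> G4 ZG S sSG _ SV leS3.
apply: cayley_commuting_integral => //; last first.
  by move=> s /(subsetP sSG)/G4.
move=> s t Ss St; have [Gs Gt] := (subsetP sSG s Ss, subsetP sSG t St).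
have [s2 | s2] := eqVneq (s ^+ 2) 1; first exact/commute_sym/(centerC Gt)/ZG.
have [t2 | t2] := eqVneq (t ^+ 2) 1; first exact/(centerC Gs)/ZG.
have inv x : x \in S -> x^-1 \in S by rewrite {2}SV mem_invg invgK.
have neq_inv (x : gT) : x ^+ 2 != 1 -> x != x^-1.
  by move=> x2; rewrite eq_sym eq_invg_mul.
have [-> // | nts] := eqVneq t s.
have [-> | ntsV] := eqVneq t s^-1; first by rewrite mulVg mulgV.
(* Otherwise s, s^-1, t, t^-1 would be four distinct elements of S. *)
have: s |: (s^-1 |: (t |: [set t^-1])) \subset S.
  by rewrite !subUset !sub1set Ss St !inv.
move/subset_leq_card/leq_trans/(_ leS3).
rewrite !cardsU1 cards1 !inE !negb_or (neq_inv s) // (neq_inv t) //.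
rewrite (eq_sym s t) nts (eq_sym s^-1 t) ntsV eqg_inv (eq_sym s t) nts.
by rewrite -(eqg_inv s) invgK (eq_sym _ t) ntsV.
Qed.

(** * Minimal non-abelian groups of exponent 4 *)

Lemma mem_joing_cycles (gT : finGroupType) (a b : gT) :
  (a \in <[a]> <*> <[b]>) && (b \in <[a]> <*> <[b]>).
Proof. by rewrite -!cycle_subG joing_subl joing_subr. Qed.

(** Modulo [A] the generators commute and square to 1, so [H / A] is a quotient of the four-group.
    The subgroup [A] will be the center, the Frattini subgroup, or the group of central involutions
    with 1. *)
Lemma quotient_gen2 (gT : finGroupType) (H A : {group gT}) (a b : gT) :
    <[a]> <*> <[b]> = H -> H \subset 'N(A) ->
    a ^+ 2 \in A -> b ^+ 2 \in A -> [~ a, b] \in A ->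
  [/\ 2.-abelem (H / A), #|H / A| <= 4
    & forall h, h \in H -> exists i j : bool,
        exists2 e, e \in A & h = a ^+ i * b ^+ j * e].
Proof.
move=> defH nAH Aa Ab Ac.
have /andP[Ha Hb] : (a \in H) && (b \in H).
  by rewrite -defH mem_joing_cycles.
have [Na Nb] := (subsetP nAH a Ha, subsetP nAH b Hb).
have defHA : <[coset A a]> <*> <[coset A b]> = H / A.
  by rewrite -defH quotientY ?cycle_subG // !quotient_cycle.
have cab : commute (coset A a) (coset A b).
  by apply/commgP; rewrite -morphR //= coset_id.
have sq x : x \in 'N(A) -> x ^+ 2 \in A -> coset A x ^+ 2 = 1.
  by move=> Nx Ax; rewrite -morphX //= coset_id.
have cBA : <[coset A b]> \subset 'C(<[coset A a]>).
  by rewrite cycle_subG /= cent_cycle; apply/cent1P.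
have defHA2 : <[coset A a]> * <[coset A b]> = H / A by rewrite -cent_joinEr.
have abelHA : abelian (H / A) by rewrite -defHA abelianY !cycle_abelian cBA.
have le2 (x : coset_of A) : x ^+ 2 = 1 -> #|<[x]>| <= 2.
  by move=> x2; apply: dvdn_leq; rewrite // -/(order x) order_dvdn x2.
split.
- apply/abelemP => //; split=> // u.
  rewrite /= -defHA2 => /mulsgP[_ _ /cycleP[i ->] /cycleP[j ->] ->].
  rewrite expgMn; last exact: commuteX2.
  by rewrite -!expgM !(mulnC _ 2) !expgM !sq // !expg1n mulg1.
- have := leq_mul (le2 _ (sq a Na Aa)) (le2 _ (sq b Nb Ab)).
  rewrite mul_cardG defHA2; apply: leq_trans.
  by rewrite leq_pmulr ?cardG_gt0.
move=> h Hh; have Nh := subsetP nAH h Hh.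
have: coset A h \in H / A by rewrite mem_quotient.
rewrite -defHA2 => /mulsgP[_ _ /cycleP[i ->] /cycleP[j ->] eq_h].
exists (odd i), (odd j), ((a ^+ odd i * b ^+ odd j)^-1 * h);
  last by rewrite mulKVg.
have expodd (x : coset_of A) k : x ^+ 2 = 1 -> x ^+ k = x ^+ odd k.
  move=> x2; rewrite -[in LHS](odd_double_half k) expgD -mul2n expgM x2.
  by rewrite expg1n mulg1.
apply: coset_idr; rewrite ?groupM ?groupV ?groupM ?groupX //.
rewrite morphM ?groupV ?groupM ?groupX // morphV ?groupM ?groupX //=.
rewrite eq_h morphM ?groupX // !morphX //.
rewrite -(expodd _ i) ?sq // -(expodd _ j) ?sq //.
by rewrite mulVg.
Qed.

(** Since [H / 'Z(H)] is elementary abelian, the Frattini subgroup is central; it has index at most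
    4. A maximal subgroup is therefore cyclic modulo a central subgroup, hence abelian. *)
Lemma minimal_nonabelian_gen2 (gT : finGroupType) (H : {group gT}) (a b : gT) :
    2.-group H -> <[a]> <*> <[b]> = H ->
    a ^+ 2 \in 'Z(H) -> b ^+ 2 \in 'Z(H) ->
    [~ a, b] \in 'Z(H) -> [~ a, b] != 1 ->
  minimal_nonabelian H.
Proof.
move=> pH defH Za Zb Zc c1.
have /andP[Ha Hb] : (a \in H) && (b \in H).
  by rewrite -defH mem_joing_cycles.
have nZH : H \subset 'N('Z(H)) by rewrite normal_norm ?center_normal.
have [abelHZ _ _] := quotient_gen2 defH nZH Za Zb Zc.
have sPhiZ : 'Phi(H) \subset 'Z(H) by apply: Phi_min pH nZH abelHZ.
have nPhiH : H \subset 'N('Phi(H)) by rewrite normal_norm ?Phi_normal.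
have PhiX x : x \in H -> x ^+ 2 \in 'Phi(H).
  move=> Hx; rewrite (Phi_joing pH) (subsetP (joing_subr _ _)) //.
  by rewrite (Mho_p_elt 1) ?(mem_p_elt pH).
have Phic : [~ a, b] \in 'Phi(H).
  by rewrite (Phi_joing pH) (subsetP (joing_subl _ _)) // derg1 mem_commg.
have [_ leHPhi _] := quotient_gen2 defH nPhiH (PhiX a Ha) (PhiX b Hb) Phic.
split.
  by apply: contra c1 => /centsP cHH; apply/commgP/cHH.
move=> K; rewrite properEneq => /andP[neKH sKH].
have [/val_inj eKH | [M maxM sKM]] := maximal_exists sKH.
  by rewrite eKH eqxx in neKH.
apply: abelianS sKM _.
have sPhiM := Phi_sub_max maxM.
have ltMH : M \proper H by case/maxgroupP: maxM.
apply: (@cyclic_factor_abelian _ 'Phi(H)).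
  rewrite subsetI sPhiM (subset_trans sPhiZ) //.
  rewrite (subset_trans (subsetIr _ _)) //.
  by rewrite centS ?proper_sub.
have ltMPhi : #|M / 'Phi(H)| < 4.
  apply: leq_trans leHPhi; apply: proper_card.
  rewrite quotient_proper ?Phi_normal //; apply/andP; split=> //.
  exact: subset_trans (proper_sub ltMH) nPhiH.
have qM : 2.-group (M / 'Phi(H)).
  by rewrite quotient_pgroup // (pgroupS (proper_sub ltMH)).
have [k oM] := p_natP qM.
have : k < 2 by rewrite -(ltn_exp2l _ _ (isT : 1 < 2)) -oM.
case: k oM => [|[|//]] oM _; last by rewrite prime_cyclic ?oM.
by rewrite (card1_trivg oM) cyclic1.
Qed.

Lemma sqr_mul_commg (gT : finGroupType) (a b : gT) :
  commute a (b ^+ 2) -> (a * b) ^+ 2 = a ^+ 2 * b ^+ 2 * [~ a, b].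
Proof.
move=> cab2.
have E : b ^+ 2 * a^-1 = a^-1 * b ^+ 2.
  by apply/esym/commute_sym/commuteV/commute_sym.
rewrite commgEl conjgE -(mulgA (a ^+ 2)) (mulgA (b ^+ 2)) E !expg2.
by rewrite -!mulgA !mulKVg.
Qed.

(* Modulo the involutions of the center, an element outside the center is
   a, b or ab, and multiplying by a central involution preserves the square. *)
Lemma central_involutions_gen2 (gT : finGroupType) (H : {group gT}) (a b : gT) :
    2.-group H -> <[a]> <*> <[b]> = H ->
    a ^+ 4 = 1 -> b ^+ 4 = 1 -> a ^+ 2 \in 'Z(H) -> b ^+ 2 \in 'Z(H) ->
    [~ a, b] \in 'Z(H) -> a ^+ 2 != 1 -> b ^+ 2 != 1 ->
    a ^+ 2 * b ^+ 2 * [~ a, b] != 1 ->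
  forall z, z \in H -> z ^+ 2 = 1 -> z \in 'Z(H).
Proof.
move=> pH defH a4 b4 Za Zb Zc a2 b2 ab2.
have /andP[Ha Hb] : (a \in H) && (b \in H).
  by rewrite -defH mem_joing_cycles.
have cZ x y : x \in H -> y \in 'Z(H) -> commute x y.
  by move=> Hx /setIP[_ /centP cHy]; apply/commute_sym/cHy.
have c2 : [~ a, b] ^+ 2 = 1.
  rewrite -commXg; last exact: cZ.
  by apply/eqP/commgP/commute_sym/cZ.
have pZ : 2.-group 'Z(H) by rewrite (pgroupS (center_sub H)).
have abelO := Ohm1_abelem pZ (center_abelian H).
have [abO expO] := abelemP (isT : prime 2) abelO.
have OE x : x \in 'Z(H) -> x ^+ 2 = 1 -> x \in 'Ohm_1('Z(H)).
  by move=> Zx x2; rewrite (OhmEabelian pZ abO); apply/LdivP.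
have sOZ : 'Ohm_1('Z(H)) \subset 'Z(H) by apply: Ohm_sub.
have nOH : H \subset 'N('Ohm_1('Z(H))).
  by apply: cents_norm; rewrite centsC (subset_trans sOZ) ?subsetIr.
have [||| _ _ genH] := quotient_gen2 defH nOH.
- by apply: OE; rewrite // -expgM.
- by apply: OE; rewrite // -expgM.
- exact: OE.
move=> z Hz; have [i [j [e Oe ->]]] := genH z Hz.
have Ze := subsetP sOZ e Oe.
rewrite expgMn; last by apply: cZ; rewrite ?groupM ?groupX.
rewrite (expO e Oe) mulg1.
case: i; case: j; rewrite ?expg0 ?expg1 ?mulg1 ?mul1g //.
- by rewrite sqr_mul_commg; [move/eqP; rewrite (negPf ab2) | apply: cZ].
- by move/eqP; rewrite (negPf a2).
- by move/eqP; rewrite (negPf b2).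
Qed.

(** * Elements of order dividing 4 *)

Lemma order4 (gT : finGroupType) (x : gT) :
  x ^+ 4 = 1 -> x ^+ 2 != 1 -> #[x] = 4.
Proof.
move=> x4 x2; have x_dvd4 : #[x] %| 4 by rewrite order_dvdn x4.
have x_ndvd2 : ~~ (#[x] %| 2) by rewrite order_dvdn.
have := dvdn_leq (isT : 0 < 4) x_dvd4.
by case: #[x] x_dvd4 x_ndvd2 => [|[|[|[|[|n]]]]].
Qed.

Lemma order_le4 (gT : finGroupType) (x : gT) : x ^+ 4 = 1 -> #[x] <= 4.
Proof. by move=> x4; rewrite dvdn_leq // order_dvdn x4. Qed.

Lemma order_le2 (gT : finGroupType) (x : gT) : x ^+ 2 = 1 -> #[x] <= 2.
Proof. by move=> x2; rewrite dvdn_leq // order_dvdn x2. Qed.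

(** Every nontrivial subgroup of a cyclic group of order 4 contains its unique involution, here
    [b ^+ 2]. *)
Lemma TI_cycle4 (gT : finGroupType) (A : {group gT}) (b : gT) :
  b ^+ 4 = 1 -> b ^+ 2 \notin A -> A :&: <[b]> = 1.
Proof.
move=> b4 Ab2; apply/trivgP/subsetP => u /setIP[Abk /cycleP[k def_bk]].
move: Abk; rewrite {}def_bk inE -[k]odd_double_half -mul2n expgD expgM.
have b22 : (b ^+ 2) ^+ 2 = 1 by rewrite -expgM.
have evn m : (b ^+ 2) ^+ m = (b ^+ 2) ^+ odd m.
  by rewrite -[in LHS](odd_double_half m) -mul2n expgD expgM b22 expg1n mulg1.
rewrite (evn k./2); case: (odd k) => /= Abk; last first.
  move: Abk; rewrite mul1g; case: (odd _) => /=; last by rewrite expg0.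
  by rewrite expg1 (negPf Ab2).
case/negP: Ab2; have := groupX 2 Abk.
rewrite expg1 expgMn; last by apply/commuteX/commuteX.
by rewrite -[X in _ * X]expgM mulnC expgM b22 expg1n mulg1.
Qed.

(** This serves both Q_8 and H_2. Here [[~ a, b] = a ^+ 2], so [a ^+ 2 * b ^+ 2 * [~ a, b]] is just
    [b ^+ 2], and [a ^+ 2 = 1] would make [a] and [b] commute. *)
Lemma inverting_involutions_central (gT : finGroupType) (H : {group gT})
    (a b : gT) :
    2.-group H -> ~~ abelian H -> <[a]> <*> <[b]> = H ->
    a ^+ 4 = 1 -> b ^+ 4 = 1 -> a ^ b = a^-1 -> b ^+ 2 != 1 ->
  forall z, z \in H -> z ^+ 2 = 1 -> z \in 'Z(H).
Proof.
move=> pH nabH defH a4 b4 ab b2.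
have /andP[Ha Hb] : (a \in H) && (b \in H).
  by rewrite -defH mem_joing_cycles.
have ZH x : x \in H -> commute x a -> commute x b -> x \in 'Z(H).
  move=> Hx cxa cxb; rewrite inE Hx -sub_cent1 -defH join_subG !cycle_subG /=.
  by apply/andP; split; apply/cent1P.
have a2V : a ^- 2 = a ^+ 2 by apply/eqP; rewrite eq_invg_mul -expgD a4.
have c_a2 : [~ a, b] = a ^+ 2 by rewrite commgEl ab -invMg.
have Za : a ^+ 2 \in 'Z(H).
  apply: ZH; rewrite ?groupX //; first exact/commute_sym/commuteX.
  by apply/commgP/conjg_fixP; rewrite conjXg ab expgVn a2V.
have Zb : b ^+ 2 \in 'Z(H).
  apply: ZH; rewrite ?groupX //; last exact/commute_sym/commuteX.
  apply/commute_sym/commgP/conjg_fixP.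
  by rewrite expg2 conjgM ab conjVg ab invgK.
have a2 : a ^+ 2 != 1.
  apply: contra nabH => /eqP a2; rewrite -defH abelianY !cycle_abelian.
  rewrite cycle_subG /= cent_cycle; apply/cent1P/commute_sym/commgP.
  by rewrite c_a2 a2.
apply: (central_involutions_gen2 pH defH a4 b4 Za Zb _ a2 b2); rewrite c_a2 //.
by rewrite -mulgA (centerC (groupX 2 Hb) Za) (mulgA (a ^+ 2)) -expgD a4 mul1g.
Qed.

(** * Involutions of Q_8 and H_2 *)

Lemma Q8_involutions_central (gT : finGroupType) (H : {group gT}) :
    2.-group H -> ~~ abelian H -> H \isog 'Q_8 ->
  forall z, z \in H -> z ^+ 2 = 1 -> z \in 'Z(H).
Proof.
move=> pH nabH /(isoGrpP _ (Grp_quaternion (isT : 2 < 3)))[_].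
case/existsP=> -[a b] /=; rewrite !xpair_eqE.
(* The presentation of ['Q_8] states its exponents as powers of 2, which compute to 4 and 2. *)
case/and4P=> /eqP defH /eqP a4 /eqP b2 /eqP ab; have {}a4 : a ^+ 4 = 1 := a4.
have {}b2 : b ^+ 2 = a ^+ 2 := b2.
apply: (inverting_involutions_central pH nabH defH a4 _ ab).
  by rewrite (expgM _ 2 2) b2 -expgM.
apply: contra nabH => /eqP b21; rewrite -defH abelianY !cycle_abelian.
rewrite cycle_subG /= cent_cycle; apply/cent1P/commute_sym/commgP.
by rewrite commgEl ab -invMg -expg2 invg_eq1 -b2 b21.
Qed.

(* Extremal.gtype 4 4 3 is C_4 : C_4, where a generator of the acting factor
   inverts the other one (3 = -1 mod 4). *)
Local Notation ED44 := [set: Extremal.gtype 4 4 4.-1].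

Lemma card_ED44 : #|ED44| = 16.
Proof. exact: card_ext_dihedral. Qed.

Lemma Grp_ED44 : iso_H2 ED44.
Proof. exact: Grp_ext_dihedral. Qed.

(** Finite groups with the same presentation are homomorphic images of each other, so the order
    carries over from [ED44]. *)
Lemma card_H2 (gT : finGroupType) (H : {group gT}) : iso_H2 H -> #|H| = 16.
Proof.
move=> isoH; rewrite -card_ED44; apply: card_isog.
rewrite isogEhom Grp_ED44 isoH.
by rewrite (isoGrp_hom isoH) (isoGrp_hom Grp_ED44).
Qed.

Lemma H2_intro (gT : finGroupType) (H : {group gT}) (a b : gT) :
    <[a]> <*> <[b]> = H -> a ^+ 4 = 1 -> b ^+ 4 = 1 -> a ^ b = a^-1 ->
    16 <= #|H| ->
  iso_H2 H.
Proof.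
move=> defH a4 b4 ab leH.
apply: (isoGrp_trans _ Grp_ED44).
rewrite isogEcard card_ED44 leH andbT Grp_ED44.
by apply/existsP; exists (a, b); rewrite /= defH a4 b4 ab !eqxx.
Qed.

Lemma H2_involutions_central (gT : finGroupType) (H : {group gT}) :
    2.-group H -> ~~ abelian H -> iso_H2 H ->
  forall z, z \in H -> z ^+ 2 = 1 -> z \in 'Z(H).
Proof.
move=> pH nabH isoH; have oH := card_H2 isoH.
have /existsP[[a b]] := isoGrp_hom isoH; rewrite /= !xpair_eqE.
case/and4P=> /eqP defH /eqP a4 /eqP b4 /eqP ab.
apply: (inverting_involutions_central pH nabH defH a4 b4 ab).
(* With [b ^+ 2 = 1] the product of the two cyclic groups would have at most 8 elements instead of
   16. *)
apply: contra_eqN oH => /eqP b2.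
have nab : <[b]> \subset 'N(<[a]>).
  by rewrite cycle_subG /=; apply/normP; rewrite -cycleJ ab cycleV.
have := leq_mul (order_le4 a4) (order_le2 b2).
rewrite /order mul_cardG -norm_joinEr // defH => le8.
have: #|H| <= 8 by apply: leq_trans le8; rewrite leq_pmulr ?cardG_gt0.
by case: eqP => // ->.
Qed.

(** * The group H_32 *)

Definition H32_relations (gT : finGroupType) (a b : gT) : Prop :=
  [/\ a ^+ 4 = 1, b ^+ 4 = 1, [~ a, b] ^+ 2 = 1,
      commute [~ a, b] a & commute [~ a, b] b].

(** The third generator equals [[~ a, b]], so it already lies in the subgroup generated by the other
    two and can be eliminated. *)
Lemma homg_H32P (gT : finGroupType) (H : {group gT}) :
  reflect (exists a b : gT, <[a]> <*> <[b]> = H /\ H32_relations a b)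
    (H \homg Grp (a : b : c : a ^+ 4 = b ^+ 4 = 1, c ^+ 2 = 1,
                  [~ a, b] = c, [~ c, a] = [~ c, b] = 1)).
Proof.
have sRY (a b : gT) : <[[~ a, b]]> \subset <[a]> <*> <[b]>.
  by have /andP[Ha Hb] := mem_joing_cycles a b; rewrite cycle_subG groupR.
apply: (iffP existsP) => [[[[a b] c]] | [a [b [defH [a4 b4 c2 ca cb]]]]] /=.
  rewrite !xpair_eqE.
  case/and5P=> /eqP defH /eqP a4 /eqP b4 /eqP c2.
  case/and3P=> /eqP eq_c /commgP ca /commgP cb.
  exists a, b; rewrite /H32_relations eq_c; split=> //.
  by rewrite -defH -eq_c (joing_idPl (sRY a b)).
exists (a, b, [~ a, b]); rewrite /= !xpair_eqE !eqxx a4 b4 c2 !eqxx /=.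
rewrite -defH (joing_idPl (sRY a b)) eqxx /=.
by apply/andP; split; apply/commgP.
Qed.

(** As [a ^ b = a * [~ a, b]], the element [b] normalizes the subgroup generated by [a] and
    [[~ a, b]]. Bounds and exact orders both come from this factorization. *)
Lemma H32_factorization (gT : finGroupType) (H : {group gT}) (a b : gT) :
    <[a]> <*> <[b]> = H -> commute [~ a, b] a -> commute [~ a, b] b ->
  (<[a]> <*> <[[~ a, b]]>) * <[b]> = H
    /\ <[a]> * <[[~ a, b]]> = <[a]> <*> <[[~ a, b]]>.
Proof.
move=> defH ca cb; split; last first.
  rewrite cent_joinEr // cycle_subG /= cent_cycle.
  exact/cent1P/commute_sym.
have /andP[Ha Hb] : (a \in H) && (b \in H) by rewrite -defH mem_joing_cycles.
have /andP[Aa Ac] := mem_joing_cycles a [~ a, b].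
rewrite -norm_joinEr /=.
  rewrite -joingA (joingC <[[~ a, b]]>) joingA defH.
  by apply/joing_idPl; rewrite cycle_subG groupR.
rewrite cycle_subG inE sub_conjg join_subG !cycle_subG !mem_conjgV.
have -> : [~ a, b] ^ b = [~ a, b] by apply/conjg_fixP/commgP.
rewrite Ac andbT.
by rewrite conjg_mulR groupM.
Qed.

Lemma H32_card_le (gT : finGroupType) (H : {group gT}) (a b : gT) :
    <[a]> <*> <[b]> = H -> commute [~ a, b] a -> commute [~ a, b] b ->
  #|H| <= #[a] * #[[~ a, b]] * #[b].
Proof.
move=> defH ca cb; have [defAB defA] := H32_factorization defH ca cb.
rewrite /order mul_cardG defA.
apply: leq_trans (leq_mul (leq_pmulr _ _) (leqnn _)); last exact: cardG_gt0.
by rewrite mul_cardG defAB leq_pmulr ?cardG_gt0.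
Qed.

(** The two standard generators commute, so [c] is sent to 1 and only the exponent relations
    remain. *)
Lemma Z4Z4_homg_H32 :
  [set: 'Z_4 * 'Z_4] \homg Grp (a : b : c : a ^+ 4 = b ^+ 4 = 1, c ^+ 2 = 1,
                  [~ a, b] = c, [~ c, a] = [~ c, b] = 1).
Proof.
apply/homg_H32P; exists (Zp1, 1), (1, Zp1).
have cxy : [~ (Zp1, 1) : 'Z_4 * 'Z_4, (1, Zp1)] = 1 by apply/eqP.
split; last first.
  rewrite /H32_relations cxy expg1n.
  by split=> //; first [exact/commute_sym/commute1 | apply/eqP].
apply/setP=> -[i j]; rewrite inE.
have -> : (i, j) = (Zp1, 1) ^+ i * (1, Zp1) ^+ j :> 'Z_4 * 'Z_4.
  by case: i => [[|[|[|[|//]]]] ?]; case: j => [[|[|[|[|//]]]] ?]; apply/eqP.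
by rewrite groupM // mem_gen // inE mem_cycle ?orbT.
Qed.

(* H has a quotient Z/4 x Z/4, whose kernel contains the nontrivial [a, b]; this
   avoids constructing a group of order 32. *)
Lemma card_H32_ge (gT : finGroupType) (H : {group gT}) :
  ~~ abelian H -> iso_H32 H -> 32 <= #|H|.
Proof.
move=> nabH isoH.
have /homgP[f im_f] : [set: 'Z_4 * 'Z_4] \homg H by rewrite isoH Z4Z4_homg_H32.
have /homg_H32P[a [b [defH _]]] := isoGrp_hom isoH.
have /andP[Ha Hb] : (a \in H) && (b \in H).
  by rewrite -defH mem_joing_cycles.
have c1 : [~ a, b] != 1.
  apply: contra nabH => /commgP cab; rewrite -defH abelianY !cycle_abelian.
  by rewrite cycle_subG /= cent_cycle; apply/cent1P/commute_sym.
have kc : [~ a, b] \in 'ker f.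
  apply/kerP; rewrite ?groupR // morphR //; apply/eqP/commgP.
  by congr (_, _); apply: Zp_mulgC.
have: 1 < #|'ker f|.
  by rewrite cardG_gt1; apply: contraNneq c1 => k1; rewrite k1 inE in kc.
have := card_morphim f H; rewrite im_f setIid cardsT card_prod card_ord => oK.
rewrite -(Lagrange (subsetIl H _ : 'ker f \subset H)) -oK.
by rewrite -(@leq_pmul2r (4 * 4)).
Qed.

Lemma H32_involutions_central (gT : finGroupType) (H : {group gT}) :
    2.-group H -> ~~ abelian H -> iso_H32 H ->
  forall z, z \in H -> z ^+ 2 = 1 -> z \in 'Z(H).
Proof.
move=> pH nabH isoH; have le32 := card_H32_ge nabH isoH.
have /homg_H32P[a [b [defH [a4 b4 c2 ca cb]]]] := isoGrp_hom isoH.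
have /andP[Ha Hb] : (a \in H) && (b \in H) by rewrite -defH mem_joing_cycles.
(* The factorization bounds the order of [H] by 4 * 2 * 4 = 32, so neither [a] nor [b] can have
   order at most 2. *)
have lt32 k l m : #[a] <= k -> #[[~ a, b]] <= l -> #[b] <= m -> 32 <= k * l * m.
  move=> ak cl bm; apply: leq_trans le32 _.
  by apply: leq_trans (H32_card_le defH ca cb) _; rewrite !leq_mul.
have ZH x : x \in H -> commute x a -> commute x b -> x \in 'Z(H).
  move=> Hx cxa cxb; rewrite inE Hx -sub_cent1 -defH join_subG !cycle_subG /=.
  by apply/andP; split; apply/cent1P.
have Zc : [~ a, b] \in 'Z(H) by apply: ZH; rewrite ?groupR.
have Za : a ^+ 2 \in 'Z(H).
  apply: ZH; rewrite ?groupX //; first exact/commute_sym/commuteX.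
  by apply/commgP; rewrite commXg ?c2.
have Zb : b ^+ 2 \in 'Z(H).
  apply: ZH; rewrite ?groupX //; last exact/commute_sym/commuteX.
  by apply/commute_sym/commgP; rewrite commgX ?c2 //; apply: commute_sym.
have a2 : a ^+ 2 != 1.
  apply/negP=> /eqP/order_le2 a2.
  by have := lt32 _ _ _ a2 (order_le2 c2) (order_le4 b4).
have b2 : b ^+ 2 != 1.
  apply/negP=> /eqP/order_le2 b2.
  by have := lt32 _ _ _ (order_le4 a4) (order_le2 c2) b2.
apply: (central_involutions_gen2 pH defH a4 b4 Za Zb Zc a2 b2).
(* This relation would put [b ^+ 2] in both factors of [H], whereas an order of at least 32 forces
   factors of at most 8 and 4 elements to meet trivially. *)
apply: contra b2 => /eqP abc.
have [defAB defA] := H32_factorization defH ca cb.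
have leA : #|<[a]> <*> <[[~ a, b]]>| <= 8.
  apply: leq_trans (leq_mul (order_le4 a4) (order_le2 c2)).
  by rewrite /order mul_cardG -defA leq_pmulr ?cardG_gt0.
have leAb := leq_mul leA (order_le4 b4).
have TI : (<[a]> <*> <[[~ a, b]]>) :&: <[b]> = 1.
  apply/eqP; rewrite trivg_card_le1 -(@leq_pmul2l 32) //.
  apply: leq_trans (leq_mul le32 (leqnn _)) _.
  by rewrite -defAB -mul_cardG.
have /andP[Aa Ac] := mem_joing_cycles a [~ a, b].
suff: b ^+ 2 \in (<[a]> <*> <[[~ a, b]]>) :&: <[b]> by rewrite TI => /set1P->.
rewrite inE mem_cycle andbT.
have -> : b ^+ 2 = a ^- 2 * [~ a, b]^-1.
  apply: (mulgI (a ^+ 2)); rewrite mulKVg.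
  by apply: (mulIg [~ a, b]); rewrite abc mulVg.
by rewrite groupM // groupV ?groupX.
Qed.

(* The subgroup of H x K generated by the pairs of corresponding generators also
   satisfies the relations, so it has at most 32 elements and projects
   isomorphically onto H; its other projection maps onto K. *)
Lemma H32_intro (gT : finGroupType) (H : {group gT}) (a b : gT) :
  <[a]> <*> <[b]> = H -> H32_relations a b -> 32 <= #|H| -> iso_H32 H.
Proof.
move=> defH relab le32; apply: intro_isoGrp => [|rT K].
  by apply/homg_H32P; exists a, b.
case/homg_H32P=> x [y [defK [x4 y4 d2 dx dy]]].
have [a4 b4 c2 ca cb] := relab.
pose u : gT * rT := (a, x); pose v : gT * rT := (b, y).
have uvE : [~ u, v] = ([~ a, b], [~ x, y]) by [].
have leL : #|<[u]> <*> <[v]>| <= 32.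
  have defL : <[u]> <*> <[v]> = (<[u]> <*> <[v]>)%G by [].
  apply: (leq_trans (H32_card_le defL _ _)).
  - rewrite uvE; transitivity ([~ a, b] * a, [~ x, y] * x) => //.
    by rewrite ca dx.
  - rewrite uvE; transitivity ([~ a, b] * b, [~ x, y] * y) => //.
    by rewrite cb dy.
  apply: (@leq_mul _ _ 8 4); first apply: (@leq_mul _ _ 4 2).
  - by apply: order_le4; transitivity (a ^+ 4, x ^+ 4) => //; rewrite a4 x4.
  - apply: order_le2; rewrite uvE.
    by transitivity ([~ a, b] ^+ 2, [~ x, y] ^+ 2) => //; rewrite c2 d2.
  - by apply: order_le4; transitivity (b ^+ 4, y ^+ 4) => //; rewrite b4 y4.
have im_fst : @fst gT rT @* (<[u]> <*> <[v]>) = H.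
  by rewrite morphimY ?subsetT // !morphim_cycle ?inE.
have im_snd : @snd gT rT @* (<[u]> <*> <[v]>) = K.
  by rewrite morphimY ?subsetT // !morphim_cycle ?inE.
have isoHL : H \isog <[u]> <*> <[v]>.
  rewrite isogEcard (leq_trans leL) // andbT -im_fst.
  exact: morphim_homg.
rewrite -im_snd; apply: homg_trans (morphim_homg _ _) _.
  exact: subsetT.
by rewrite isog_hom // isog_sym.
Qed.

(** * Recognizing the three groups from two generators *)

Lemma involution_cycle4 (gT : finGroupType) (x y : gT) :
  x ^+ 4 = 1 -> x ^+ 2 != 1 -> y \in <[x]> -> y ^+ 2 = 1 -> y = 1 \/ y = x ^+ 2.
Proof.
move=> x4 x2 /cycleP[k ->]; rewrite -expgM => /eqP.
rewrite -order_dvdn (order4 x4 x2) (@dvdn_pmul2r 2 2) // => /dvdnP[m ->].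
have x22 : (x ^+ 2) ^+ 2 = 1 by rewrite -expgM.
rewrite mulnC expgM -(odd_double_half m) expgD -mul2n (expgM _ 2) x22.
by rewrite expg1n mulg1; case: (odd m); [right | left].
Qed.

Section MinimalNonabelianTypes.

Variables (gT : finGroupType) (H : {group gT}) (a b : gT).
Hypotheses (nabH : ~~ abelian H) (defH : <[a]> <*> <[b]> = H).
Hypotheses (a4 : a ^+ 4 = 1) (b4 : b ^+ 4 = 1).
Hypotheses (a2 : a ^+ 2 != 1) (b2 : b ^+ 2 != 1).

Let sAH : <[a]> \subset H. Proof. by rewrite -defH joing_subl. Qed.
Let sBH : <[b]> \subset H. Proof. by rewrite -defH joing_subr. Qed.

Let inverts : [~ a, b] = a ^+ 2 -> a ^ b = a^-1.
Proof.
move=> c_a2; rewrite conjg_mulR c_a2 -expgS; apply/esym/eqP.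
by rewrite eq_invg_mul -expgS a4.
Qed.

(** The only involution of [<[a]>] is [a ^+ 2], so [<[a]>] and [<[b]>] meet trivially and their
    product already has 16 elements. *)
Lemma H2_of_commutator : [~ a, b] = a ^+ 2 -> b ^+ 2 != a ^+ 2 -> iso_H2 H.
Proof.
move=> c_a2 ba; apply: (H2_intro defH a4 b4 (inverts c_a2)).
have TI : <[a]> :&: <[b]> = 1.
  apply: TI_cycle4 => //; apply/negP => /(involution_cycle4 a4 a2)[].
  - by rewrite -expgM.
  - exact/eqP.
  - exact/eqP.
have := TI_cardMg TI; rewrite -!/(order _) (order4 a4 a2) (order4 b4 b2) => oAB.
apply: (@leq_trans #|<[a]> * <[b]>|); first by rewrite oAB.
by apply: subset_leq_card; rewrite mul_subG.
Qed.

(** The relations make [H] an image of ['Q_8]; being non-abelian, [H] strictly contains [<[a]>] and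
    so has order at least 8. *)
Lemma Q8_of_commutator : [~ a, b] = a ^+ 2 -> b ^+ 2 = a ^+ 2 -> H \isog 'Q_8.
Proof.
move=> c_a2 ba.
have homQ : H \homg [set: 'Q_8].
  rewrite (Grp_quaternion (isT : 2 < 3)); apply/existsP; exists (a, b).
  rewrite /= defH ba (inverts c_a2) !xpair_eqE !eqxx /= andbT.
  exact/eqP.
rewrite isogEcard homQ (card_quaternion (isT : 2 < 3)).
rewrite -(Lagrange sAH) -/(order a) (order4 a4 a2) (@leq_pmul2l 4 2) //.
rewrite indexg_gt1; apply: contra nabH => sHA.
exact: abelianS sHA (cycle_abelian a).
Qed.

(** The inequalities say that [[~ a, b]] is not in [<[a]>] and that [b ^+ 2] is none of 1, [a ^+ 2],
    [[~ a, b]] and [a ^+ 2 * [~ a, b]]. These are all the solutions of [u ^+ 2 = 1] in the first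
    factor, so the orders multiply to 32. *)
Lemma H32_of_commutator :
    [~ a, b] ^+ 2 = 1 -> commute [~ a, b] a -> commute [~ a, b] b ->
    [~ a, b] != 1 -> [~ a, b] != a ^+ 2 -> b ^+ 2 != a ^+ 2 ->
    [~ a, b] != b ^+ 2 -> a ^+ 2 * b ^+ 2 * [~ a, b] != 1 ->
  iso_H32 H.
Proof.
move=> c2 ca cb c1 c_a2 ba c_b2 abc; apply: (H32_intro defH) => //.
have [defAB defA] := H32_factorization defH ca cb.
have oc : #[[~ a, b]] = 2 by apply: nt_prime_order.
have TIac : <[a]> :&: <[[~ a, b]]> = 1.
  rewrite setIC prime_TIg -?/(order _) ?oc // cycle_subG.
  by apply/negP => cA; case: (involution_cycle4 a4 a2 cA c2); apply/eqP.
have TI : (<[a]> <*> <[[~ a, b]]>) :&: <[b]> = 1.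
  apply: TI_cycle4 => //; rewrite /= -defA.
  apply/negP => /mulsgP[u w au /cycleP[j ->] eq_b].
  have cV : [~ a, b]^-1 = [~ a, b] by apply/eqP; rewrite eq_invg_mul -expg2 c2.
  have := eq_b; rewrite -(odd_double_half j) expgD -mul2n expgM c2 expg1n mulg1.
  case: (odd j) => /= {}eq_b; rewrite ?expg1 ?expg0 ?mulg1 in eq_b.
    have eq_u : u = b ^+ 2 * [~ a, b] by rewrite eq_b -mulgA -expg2 c2 mulg1.
    have u2 : u ^+ 2 = 1.
      rewrite eq_u expgMn; last exact/commute_sym/commuteX.
      by rewrite c2 mulg1 -expgM.
    case: (involution_cycle4 a4 a2 au u2) => u_eq.
      by case/eqP: c_b2; rewrite eq_b u_eq mul1g.
    by case/eqP: abc; rewrite -mulgA -eq_u u_eq -expgD.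
  case: (involution_cycle4 a4 a2 au); rewrite -eq_b -?expgM //; exact/eqP.
have oA : #|<[a]> <*> <[[~ a, b]]>| = 8.
  by rewrite -defA (TI_cardMg TIac) -!/(order _) (order4 a4 a2) oc.
by rewrite -defAB (TI_cardMg TI) oA -/(order b) (order4 b4 b2).
Qed.

End MinimalNonabelianTypes.

(** * The classification and its converse *)

(** Any non-commuting pair generates [H]. Each coincidence among [a ^+ 2], [b ^+ 2] and [[~ a, b]]
    yields, after a change of generators, one generator inverted by the other; with no coincidence
    [H] is H_32. *)
Lemma minimal_nonabelian_types (gT : finGroupType) (H : {group gT}) :
    {in H, forall x, x ^+ 4 = 1} ->
    (forall z, z \in H -> z ^+ 2 = 1 -> z \in 'Z(H)) ->
    minimal_nonabelian H ->
  [\/ H \isog 'Q_8, iso_H2 H | iso_H32 H].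
Proof.
move=> H4 ZH [nabH minH].
have /subsetPn[a Ha] := nabH; rewrite -sub_cent1 => /subsetPn[b Hb ncab].
have c1 : [~ a, b] != 1 by apply: contra ncab => /commgP cab; apply/cent1P.
have defH : <[a]> <*> <[b]> = H.
  have sLH : <[a]> <*> <[b]> \subset H by rewrite join_subG !cycle_subG Ha Hb.
  apply/eqP; rewrite eqEproper sLH; apply: contra c1 => /minH/centsP cL.
  have /andP[La Lb] := mem_joing_cycles a b.
  by apply/commgP/cL.
have sqZ x : x \in H -> x ^+ 2 \in 'Z(H).
  by move=> Hx; apply: ZH; rewrite ?groupX // -expgM H4.
have cZ x y : x \in H -> y \in 'Z(H) -> commute y x.
  by move=> Hx Zy; apply/commute_sym/(centerC Hx Zy).
have Zc : [~ a, b] \in 'Z(H).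
  (* A commutator is a product of squares. *)
  have -> : [~ a, b] = a^-1 ^+ 2 * (a * b^-1) ^+ 2 * b ^+ 2.
    by rewrite commgEl conjgE !expg2 -!mulgA !mulKg.
  by apply: groupM; [apply: groupM|]; apply: sqZ; rewrite ?groupM ?groupV.
have c2 : [~ a, b] ^+ 2 = 1.
  rewrite -commXg; last by apply/commute_sym/cZ.
  by apply/eqP/commgP/cZ => //; apply: sqZ.
have cV : [~ b, a] = [~ a, b].
  by rewrite -invg_comm; apply/eqP; rewrite eq_invg_mul -expg2 c2.
have ncZ x y : x \in H -> y \in H -> [~ x, y] != 1 -> x ^+ 2 != 1.
  move=> Hx Hy; apply: contra => /eqP x2; apply/commgP/cZ => //.
  exact: ZH.
have a2 := ncZ a b Ha Hb c1.
have b2 : b ^+ 2 != 1 by apply: ncZ Hb Ha _; rewrite cV.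
have abE : (a * b) ^+ 2 = a ^+ 2 * b ^+ 2 * [~ a, b].
  by apply: sqr_mul_commg; apply/commute_sym/cZ/sqZ.
have cabE : [~ a * b, a] = [~ a, b].
  by rewrite commMgJ commgg conj1g mul1g cV.
have ab2 : (a * b) ^+ 2 != 1 by apply: (ncZ _ a); rewrite ?groupM ?cabE.
have [ca | c_a2] := eqVneq [~ a, b] (a ^+ 2).
  have [ba | ba] := eqVneq (b ^+ 2) (a ^+ 2).
    by constructor 1; apply: (Q8_of_commutator nabH defH); rewrite ?H4.
  by constructor 2; apply: (H2_of_commutator defH); rewrite ?H4.
(* Since [[~ b, a] = [~ a, b]], the generators can exchange roles: now [a] inverts [b]. *)
have [cb | c_b2] := eqVneq [~ a, b] (b ^+ 2).
  constructor 2; apply: (@H2_of_commutator _ _ b a); rewrite ?H4 ?cV //.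
    by rewrite joingC.
  by rewrite -cb eq_sym.
have [ba | ba] := eqVneq (b ^+ 2) (a ^+ 2).
  have abc : (a * b) ^+ 2 = [~ a, b].
    by rewrite abE ba -expgD (H4 a Ha) mul1g.
  (* Here (ab)^2 = a^2 b^2 c = c, so ab is inverted by a. *)
  constructor 2.
  apply: (@H2_of_commutator _ _ (a * b) a); rewrite ?H4 ?groupM //.
  - apply/eqP; rewrite eqEsubset join_subG !cycle_subG groupM //= Ha /=.
    rewrite -defH join_subG !cycle_subG.
    have /andP[Lab La] := mem_joing_cycles (a * b) a.
    by rewrite La /= -[X in X \in _](mulKg a b) groupM ?groupV.
  - by rewrite cabE abc.
  - by rewrite abc eq_sym.
constructor 3.
by apply: (H32_of_commutator defH); rewrite ?H4 -?abE //; apply: cZ.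
Qed.

Lemma types_involutions_central (gT : finGroupType) (G : {group gT}) :
    2.-group G -> {in G, forall x, x ^+ 4 = 1} ->
    (forall H : {group gT}, H \subset G -> minimal_nonabelian H ->
       [\/ H \isog 'Q_8, iso_H2 H | iso_H32 H]) ->
  forall z, z \in G -> z ^+ 2 = 1 -> z \in 'Z(G).
Proof.
move=> pG G4 typG.
(* The two commutation hypotheses make [x ^+ 2] and [[~ z, x]], which is [z * z ^ x], central in the
   subgroup generated by [z] and [x]. If [z] and [x] did not commute, it would be minimal
   non-abelian with [z] a non-central involution. *)
have commI x z : x \in G -> z \in G -> z ^+ 2 = 1 ->
    commute z (x ^+ 2) -> commute z (z ^ x) -> commute z x.
  move=> Gx Gz z2 czx2 czzx; apply/eqP/negPn/negP => nczx.
  pose H := (<[z]> <*> <[x]>)%G.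
  have sHG : H \subset G by rewrite join_subG !cycle_subG Gz.
  have pH : 2.-group H := pgroupS sHG pG.
  have /andP[Hz Hx] := mem_joing_cycles z x.
  have ZH u : u \in H -> commute u z -> commute u x -> u \in 'Z(H).
    move=> Hu cuz cux; rewrite inE Hu -sub_cent1 join_subG !cycle_subG /=.
    by apply/andP; split; apply/cent1P.
  have zz : z * z = 1 by rewrite -z2.
  have cE : [~ z, x] = z * z ^ x.
    by rewrite commgEl; congr (_ * _); apply/eqP; rewrite eq_invg_mul zz.
  have c1 : [~ z, x] != 1 by apply: contra nczx => /commgP/eqP.
  have Zc : [~ z, x] \in 'Z(H).
    apply: ZH; rewrite ?groupR // cE.
      exact/commute_sym/commuteM.
    apply/commgP/conjg_fixP; rewrite conjMg -conjgM -expg2 [RHS]czzx.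
    congr (_ * _).
    exact/conjg_fixP/commgP.
  have Zx2 : x ^+ 2 \in 'Z(H).
    by apply: ZH; rewrite ?groupX //; apply/commute_sym/commuteX.
  have Zz2 : z ^+ 2 \in 'Z(H) by rewrite z2.
  have minH : minimal_nonabelian H.
    exact: (minimal_nonabelian_gen2 pH (erefl _) Zz2 Zx2 Zc c1).
  have ZHz : z \in 'Z(H).
    have nabH := minH.1.
    by case: (typG H sHG minH) => isoH;
      [apply: (Q8_involutions_central pH nabH isoH)
      | apply: (H2_involutions_central pH nabH isoH)
      | apply: (H32_involutions_central pH nabH isoH)].
  by case/negP: nczx; apply/eqP/commute_sym/(centerC Hx ZHz).
have comm2 s t : s \in G -> t \in G -> s ^+ 2 = 1 -> t ^+ 2 = 1 -> commute s t.
  move=> Gs Gt s2 t2; apply: commI => //; first by rewrite t2; apply: commute1.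
  have sV : s^-1 = s by apply/eqP; rewrite eq_invg_mul -expg2 s2.
  have tV : t^-1 = t by apply/eqP; rewrite eq_invg_mul -expg2 t2.
  (* s and s ^ t = t s t commute because (s t)^4 = 1. *)
  have : (s * t * (s * t))^-1 = s * t * (s * t).
    by apply/eqP; rewrite eq_invg_mul -!expg2 -expgM G4 ?groupM.
  by rewrite !invMg sV tV /commute conjgE tV !mulgA.
(* Second use of [commI]: both [x ^+ 2] and [z ^ x] square to 1, so they commute with [z] by
   [comm2]. *)
move=> z Gz z2; rewrite inE Gz; apply/centP=> x Gx; apply: commI => //.
  by apply: comm2; rewrite ?groupX // -expgM G4.
by apply: comm2; rewrite ?groupJ // -conjXg z2 conj1g.
Qed.

Theorem proposition3p5 (gT : finGroupType) (G : {group gT})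
    (G_nonabelian : ~~ abelian G) (G_2group : 2.-group G)
    (G_exponent : exponent G = 4) :
  in_G3 G <->
  (forall H : {group gT}, H \subset G -> minimal_nonabelian H ->
     [\/ H \isog 'Q_8, iso_H2 H | iso_H32 H]).
Proof.
have G4 : {in G, forall x, x ^+ 4 = 1}.
  by move=> x Gx; apply/eqP; rewrite -order_dvdn -G_exponent dvdn_exponent.
split=> [G3 H sHG minH | typG]; last first.
  exact: central_involutions_G3 (types_involutions_central G_2group G4 typG).
apply: minimal_nonabelian_types => // [x Hx | z Hz z2].
  by rewrite G4 ?(subsetP sHG).
have /setIP[_ cGz] := G3_involutions_central G4 G3 (subsetP sHG z Hz) z2.
by rewrite inE Hz (subsetP (centS sHG)).
Qed.
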